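(* Let $A$ be an $m\times n$ complex matrix and let $\tau=\min\{m,n\}$. Then $$w(A)=\phi_1(A)\supseteq\phi_2(A)\supseteq\cdots\supseteq\phi_\tau(A).$$
   Context: For an $m\times n$ complex matrix $A$, $w(A)=\{y^*Ax : x\in\mathbb{C}^n,\ y\in\mathbb{C}^m,\ \|x\|_2=\|y\|_2=1\}$. For $1\le k\le\min\{m,n\}$, the rank-$k$ numerical range $\phi_k(A)$ is the set of $z\in\mathbb{C}$ such that $PAQ=zS$ for some rank-$k$ orthogonal projections $P=MM^*$ on $\mathbb{C}^m$ and $Q=NN^*$ on $\mathbb{C}^n$ and $S=MN^*$, where $M\in\mathbb{C}^{m\times k}$, $N\in\mathbb{C}^{n\times k}$ satisfy $M^*M=N^*N=I_k$; equivalently, $z\in\phi_k(A)$ iff there exist such $M,N$ with $M^*AN=zI_k$. *)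

(* Defs.v *)
From mathcomp Require Import all_boot all_order all_algebra.
From mathcomp Require Import classical_sets reals.
From mathcomp.real_closed Require Import complex.

Set Implicit Arguments.
Unset Strict Implicit.
Unset Printing Implicit Defensive.

Import Order.TTheory GRing.Theory Num.Theory.

Local Open Scope classical_set_scope.
Local Open Scope sesquilinear_scope.
Local Open Scope ring_scope.

Definition norm2 (C : numClosedFieldType) (n : nat) (x : 'cV[C]_n) : C :=
  sqrtC (\sum_(i < n) `|x i 0| ^+ 2).

(* [y ^t* *m A *m x] is a 1 x 1 matrix; its entry is the scalar y^* A x. *)
Definition numrange (C : numClosedFieldType) (m n : nat) (A : 'M[C]_(m, n)) :
    set C :=
  [set z | exists (x : 'cV[C]_n) (y : 'cV[C]_m),
     [/\ norm2 x = 1, norm2 y = 1 & z = (y ^t* *m A *m x) 0 0]].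

Definition rank_orthoproj (C : numClosedFieldType) (n k : nat) (P : 'M[C]_n) :
    Prop :=
  [/\ P ^t* = P, P *m P = P & \rank P = k].

(* Columns are orthonormal. This is not [M \is unitarymx], which in the library
   means that the rows are, i.e. M *m M ^t* = 1%:M. *)
Definition orthonormal_cols (C : numClosedFieldType) (n k : nat)
    (M : 'M[C]_(n, k)) : Prop :=
  M ^t* *m M = 1%:M.

(* The rank-k numerical range phi_k(A). The Hermitian and idempotent conditions
   and the rank of M *m M ^t* follow from [orthonormal_cols M]; they are kept so
   that P and Q are visibly rank-k orthogonal projections. *)
Definition rank_numrange (C : numClosedFieldType) (m n : nat)
    (A : 'M[C]_(m, n)) (k : nat) : set C :=
  [set z | exists (M : 'M[C]_(m, k)) (N : 'M[C]_(n, k)),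
     [/\ orthonormal_cols M, orthonormal_cols N &
       let P := M *m M ^t* in
       let Q := N *m N ^t* in
       let S := M *m N ^t* in
       [/\ rank_orthoproj k P, rank_orthoproj k Q & P *m A *m Q = z *: S]]].

(* Main.v *)
(* Multiplying P A Q = z S by M^* and N on either side gives the equivalent
   condition M^* A N = z I_k. For l <= k it passes to the first l columns of M
   and N, which are still orthonormal; for k = 1 it reads z = y^* A x. *)
Require Import Defs.
From mathcomp Require Import all_boot all_order all_algebra.
From mathcomp Require Import classical_sets reals.
From mathcomp.real_closed Require Import complex.

Import Order.TTheory GRing.Theory Num.Theory.
Local Open Scope classical_set_scope.
Local Open Scope sesquilinear_scope.
Local Open Scope ring_scope.

Lemma conjmxM (C : numClosedFieldType) (m n p : nat) (A : 'M[C]_(m, n))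
    (B : 'M[C]_(n, p)) : (A *m B) ^t* = B ^t* *m A ^t*.
Proof. by rewrite trmx_mul map_mxM. Qed.

Lemma orthonormal_cols_rank_orthoproj (C : numClosedFieldType) (n k : nat)
    (M : 'M[C]_(n, k)) :
  orthonormal_cols M -> rank_orthoproj k (M *m M ^t*).
Proof.
move=> MM; split.
- by rewrite conjmxM trmxCK.
- by rewrite mulmxA -(mulmxA M) MM mulmx1.
apply/eqP; rewrite eqn_leq; apply/andP; split.
  exact: leq_trans (mxrankM_maxl _ _) (rank_leq_col _).
(* For the lower bound on the rank, multiply the projection on both sides so that it becomes the
   identity of size [k]; multiplication cannot raise the rank. *)
have E : M ^t* *m (M *m M ^t*) *m M = 1%:M by rewrite mulmxA MM mul1mx MM.
rewrite -[X in (X <= _)%N](mxrank1 C k) -E.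
exact: leq_trans (mxrankM_maxl _ _) (mxrankM_maxr _ _).
Qed.

Lemma rank_numrangeP (C : numClosedFieldType) (m n k : nat)
    (A : 'M[C]_(m, n)) (z : C) :
  rank_numrange A k z <->
  exists (M : 'M[C]_(m, k)) (N : 'M[C]_(n, k)),
    [/\ orthonormal_cols M, orthonormal_cols N & M ^t* *m A *m N = z%:M].
Proof.
split=> [[M [N [MM NN [_ _ E]]]]|[M [N [MM NN E]]]]; exists M, N; split=> //.
  have := congr1 (fun B => M ^t* *m B *m N) E => /=.
  rewrite -scalemxAr -scalemxAl !mulmxA MM mul1mx -!mulmxA NN !mulmx1.
  by rewrite mulmxA scalemx1.
split; [exact: orthonormal_cols_rank_orthoproj..|].
(* Regroup P A Q as M (M^* A N) N^*, whose middle factor is the scalar matrix of [z]. *)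
rewrite -!mulmxA (mulmxA A) (mulmxA (M ^t*)) (mulmxA (M ^t*)) E.
by rewrite mul_scalar_mx -scalemxAr.
Qed.

Lemma orthonormal_colsM (C : numClosedFieldType) (n k l : nat)
    (M : 'M[C]_(n, k)) (E : 'M[C]_(k, l)) :
  orthonormal_cols M -> orthonormal_cols E -> orthonormal_cols (M *m E).
Proof.
by move=> MM EE; rewrite /orthonormal_cols conjmxM mulmxA -(mulmxA _ _ M) MM mulmx1.
Qed.

(** The columns of this [pid_mx l] are the first [l] standard basis vectors of C^k; were [l] larger
    than [k], some columns would vanish. *)
Lemma orthonormal_cols_pid (C : numClosedFieldType) (k l : nat) :
  (l <= k)%N -> orthonormal_cols (pid_mx l : 'M[C]_(k, l)).
Proof.
move=> lk; rewrite /orthonormal_cols tr_pid_mx map_pid_mx mul_pid_mx minnn.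
by rewrite (minn_idPr lk) pid_mx_1.
Qed.

Lemma rank_numrange_mono (C : numClosedFieldType) (m n k l : nat)
    (A : 'M[C]_(m, n)) :
  (l <= k)%N -> rank_numrange A k `<=` rank_numrange A l.
Proof.
move=> lk z /rank_numrangeP[M [N [MM NN E]]]; apply/rank_numrangeP.
have EE := @orthonormal_cols_pid C _ _ lk.
(* Right multiplication by J = [pid_mx l] selects the first [l] columns. The compression then
   becomes J^* (z I_k) J = z J^* J = z I_l. *)
exists (M *m pid_mx l), (N *m pid_mx l); split; try exact: orthonormal_colsM.
rewrite conjmxM -!mulmxA (mulmxA A) (mulmxA (M ^t*)) (mulmxA (M ^t*)) E.
by rewrite mul_scalar_mx -scalemxAr EE scalemx1.
Qed.

(** The only entry of the 1 x 1 matrix x^* x is the squared norm of [x]. *)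
Lemma norm2_eq1 (C : numClosedFieldType) (n : nat) (x : 'cV[C]_n) :
  norm2 x = 1 <-> orthonormal_cols x.
Proof.
have E : (x ^t* *m x) 0 0 = \sum_(i < n) `|x i 0| ^+ 2.
  by rewrite mxE; apply: eq_bigr => i _; rewrite !mxE normCKC.
rewrite /norm2 /orthonormal_cols -E; split=> [x1|->]; last first.
  by rewrite mxE sqrtC1.
by apply/matrixP => i j; rewrite !ord1 -[LHS]sqrtCK x1 expr1n mxE.
Qed.

Lemma numrange_rank1 (C : numClosedFieldType) (m n : nat) (A : 'M[C]_(m, n)) :
  numrange A = rank_numrange A 1.
Proof.
apply/seteqP; split=> z.
  move=> [x [y [/norm2_eq1 x1 /norm2_eq1 y1 ->]]].
  (* The left vector [y] serves as M and the right vector [x] as N; every 1 x 1 matrix is scalar. *)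
  by apply/rank_numrangeP; exists y, x; split=> //; exact: mx11_scalar.
move=> /rank_numrangeP[y [x [y1 x1 E]]].
by exists x, y; split; [exact/norm2_eq1..|rewrite E mxE].
Qed.

Theorem proposition12 (R : realType) (m n : nat) (A : 'M[R[i]]_(m, n)) :
  numrange A = rank_numrange A 1 /\
  (forall k : nat, (1 <= k)%N -> (k < minn m n)%N ->
     rank_numrange A k.+1 `<=` rank_numrange A k).
Proof.
split=> [|k _ _]; first exact: numrange_rank1.
exact: rank_numrange_mono.
Qed.
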